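(* Let $\alpha > 1$ be fixed, and for each dimension $d$ let $L \subset \mathcal{B}$ consist of $n = \alpha^d$ independent uniformly random vectors from the unit ball $\mathcal{B} = \{\mathbf{x} \in \mathbb{R}^d : \|\mathbf{x}\| \leq 1\}$. Then, with probability $1 - o(1)$ over the randomness of $L$ (as $d \to \infty$), we have: if $\alpha \leq \sqrt{2}$, then $\operatorname{vol}(\mathcal{V}_L) = \left(\frac{\alpha^2}{4\alpha^2 - 4}\right)^{d/2 + o(d)} \operatorname{vol}(\mathcal{B})$; if $\alpha \geq \sqrt{2}$, then $\operatorname{vol}(\mathcal{V}_L) = \left(\frac{1}{\alpha^2}\right)^{d/2 + o(d)} \operatorname{vol}(\mathcal{B})$.
   Context: For $\mathbf{v} \in \mathbb{R}^d$, $\mathcal{H}_{\mathbf{v}} := \{\mathbf{x} \in \mathbb{R}^d : \|\mathbf{x}\| \leq \|\mathbf{x} - \mathbf{v}\|\}$ (Euclidean norm), and for $L \subset \mathbb{R}^d$ with $\mathbf{0} \notin L$, $\mathcal{V}_L := \bigcap_{\mathbf{v} \in L} \mathcal{H}_{\mathbf{v}}$ (a possibly unbounded convex polytope; its volume may be infinite). Asymptotic notation refers to $d \to \infty$ with $\alpha$ fixed.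
   Formalization: When α² = 4/3 the base α²/(4α²−4) equals 1, so the claim read literally would force vol(V_L) = vol(B) exactly, which has probability 0; there it is read as vol(V_L) = e^{o(d)} vol(B). The number n is α^d rounded to a neighbouring integer. *)

(* Defs.v *)
From HB Require Import structures.
From mathcomp Require Import all_boot all_order all_algebra.
From mathcomp Require Import all_classical all_reals all_analysis.

Set Implicit Arguments.
Unset Strict Implicit.
Unset Printing Implicit Defensive.

Import Order.TTheory GRing.Theory Num.Theory.
Import numFieldNormedType.Exports.

Local Open Scope classical_set_scope.
Local Open Scope ring_scope.

(* Points of R^d are d-tuples: these carry the product of the Borel
   sigma-algebras of the coordinates. *)
Notation euclid R d := (d.-tuple (measurableTypeR R)).

Section lebesgue_measure_tuple.
Context {R : realType}.

Definition consp d (p : measurableTypeR R * euclid R d) : euclid R d.+1 :=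
  [the d.+1.-tuple _ of p.1 :: p.2].

Lemma measurable_consp d : measurable_fun setT (@consp d).
Proof. exact: measurable_cons. Qed.

Definition leb_step d (m : {sigma_finite_measure set (euclid R d) -> \bar R}) :
    set (euclid R d.+1) -> \bar R :=
  pushforward (@lebesgue_measure R \x m)%E (@consp d).

Section leb_step.
Variables (d : nat) (m : {sigma_finite_measure set (euclid R d) -> \bar R}).

Let mm : {measure set (euclid R d.+1) -> \bar R} :=
  measure_function_pushforward__canonical__measure_function_Measure
    (@lebesgue_measure R \x m)%E (@measurable_consp d).

HB.instance Definition _ := Measure.copy (leb_step m) mm.

Let leb_step_sigma_finite : sigma_finite setT (leb_step m).
Proof.
have [F FT Ffin] : sigma_finite setT (@lebesgue_measure R \x m)%E.
  have /sigma_finiteP[F [TF ndF Foo]] := sigma_finiteT (@lebesgue_measure R).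
  have /sigma_finiteP[G [TG ndG Goo]] := sigma_finiteT m.
  exists (fun n => F n `*` G n).
    rewrite -setXTT TF TG predeqE => -[x y]; split.
      move=> [/= [n _ Fnx] [k _ Gky]]; exists (maxn n k) => //; split.
      - by move: x Fnx; exact/subsetPset/ndF/leq_maxl.
      - by move: y Gky; exact/subsetPset/ndG/leq_maxr.
    by move=> [n _ []/= ? ?]; split; exists n.
  move=> k; have [? ?] := Foo k; have [? ?] := Goo k.
  split; first exact: measurableX.
  by rewrite product_measure1E// lte_mul_pinfty// ge0_fin_numE.
pose unc (t : euclid R d.+1) : measurableTypeR R * euclid R d :=
  (thead t, [tuple of behead t]).
have munc : measurable_fun setT unc.
  apply/measurable_fun_pairP; split; last exact: measurable_behead.
  exact: measurable_tnth.
have uncK p : unc (consp p) = p.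
  by case: p => x y; congr pair; exact: val_inj.
exists (fun n => unc @^-1` F n).
  by rewrite -preimage_bigcup -FT preimage_setT.
move=> n; have [mF Foo] := Ffin n; split.
  by rewrite -[X in measurable X]setTI; exact: munc.
rewrite /leb_step /pushforward -comp_preimage.
rewrite (_ : unc \o _ = id) ?preimage_id//.
by apply/funext => p /=.
Qed.

HB.instance Definition _ :=
  Measure_isSigmaFinite.Build _ _ _ (leb_step m) leb_step_sigma_finite.

End leb_step.

Fixpoint lebesgue_tuple d : {sigma_finite_measure set (euclid R d) -> \bar R} :=
  match d with
  | 0 => [the {sigma_finite_measure set (euclid R 0) -> \bar R} of
           \d_([tuple] : euclid R 0)]
  | d'.+1 => leb_step (lebesgue_tuple d')
  end.

Lemma lebesgue_tuple_box d (A : 'I_d -> set (measurableTypeR R)) :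
  (forall i, measurable (A i)) ->
  lebesgue_tuple d [set x | forall i, A i (tnth x i)] =
  (\prod_(i < d) lebesgue_measure (A i))%E.
Proof.
elim: d A => [|d IH] A mA.
  by rewrite big_ord0 /= diracE mem_set//= => -[].
rewrite big_ord_recl -IH; last by move=> i; exact: mA.
pose B : set (euclid R d) := [set x | forall i, A (lift ord0 i) (tnth x i)].
have mB : measurable B.
  rewrite (_ : B = \bigcap_(i in [set: 'I_d])
      (fun x : euclid R d => tnth x i) @^-1` A (lift ord0 i)); last first.
    by apply/seteqP; split => [x Bx i _|x Bx i]; [exact: Bx|exact: (Bx i)].
  apply: fin_bigcap_measurable => // i _.
  by rewrite -[X in measurable X]setTI; exact: measurable_tnth.
rewrite -/B -product_measure1E//= /leb_step /pushforward.
congr (product_measure1 _ _ _); apply/seteqP; split => -[x y] /=.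
  move=> H; split; first by have := H ord0; rewrite tnth0.
  by move=> i; have := H (lift ord0 i); rewrite tnthS.
move=> [/= Ax By] i; case: (unliftP ord0 i) => [j ->|->].
  by rewrite tnthS; exact: By.
by rewrite tnth0.
Qed.

End lebesgue_measure_tuple.

Section euclidean.
Context {R : realType} {d : nat}.
Implicit Types (x y v : euclid R d) (L : set (euclid R d)).

Definition enorm x : R := Num.sqrt (\sum_(i < d) (tnth x i : R) ^+ 2).

Definition esub x y : euclid R d :=
  [tuple ((tnth x i : R) - (tnth y i : R) : measurableTypeR R) | i < d].

Definition unit_ball : set (euclid R d) := [set x | enorm x <= 1].

Definition halfspace v : set (euclid R d) :=
  [set x | enorm x <= enorm (esub x v)].

(* If the origin belongs to L it has no effect: halfspace of it is everything. *)
Definition voronoi L : set (euclid R d) := \bigcap_(v in L) halfspace v.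

End euclidean.

Section random_vectors.
Context {R : realType} {disp : measure_display} {Om : measurableType disp}.
Variable P : probability Om R.
Local Open Scope ereal_scope.

Definition uniform_in d (B : set (euclid R d)) (X : {RV P >-> euclid R d}) :=
  forall A, measurable A ->
    distribution P X A = lebesgue_tuple d (A `&` B) / lebesgue_tuple d B.

Definition mutually_independent {disp' : measure_display}
    {T : measurableType disp'} n (X : 'I_n -> {RV P >-> T}) :=
  forall (J : {set 'I_n}) (A : 'I_n -> set T),
    (forall i, measurable (A i)) ->
    P (\bigcap_(i in [set` J]) (X i @^-1` A i)) =
    \prod_(i in J) P (X i @^-1` A i).

End random_vectors.

(* Probability 1 - o(1) as d tends to infinity, for a sequence of events in
   possibly different probability spaces. *)
Definition with_high_probability (R : realType) (disp : nat -> measure_display)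
    (Om : forall d, measurableType (disp d))
    (P : forall d, probability (Om d) R) (E : forall d, set (Om d)) :=
  (forall d, measurable (E d)) /\ P d (E d) @[d --> \oo] --> 1%E.

(* v = c ^ (d/2 + t) * w with |t| <= e, where e plays the role of the o(d) term.
   For the base c = 1 the expression c ^ (d/2 + o(d)) carries no error term when
   read literally; it is then understood as 1 ^ (d/2) * exp (o(d)). For every
   other c > 0, c ^ (d/2 + o(d)) and c ^ (d/2) * exp (o(d)) mean the same. *)
Definition pow_half_upto (R : realType) (c : R) (d : nat) (e : R)
    (v w : \bar R) :=
  exists2 t : R, `|t| <= e &
    v = ((if c == 1 then expR t else c `^ (d%:R / 2 + t))%:E * w)%E.

(* Main.v *)
Require Import Defs.
From mathcomp Require Import all_boot all_order all_algebra.
From mathcomp Require Import all_classical all_reals all_analysis.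
From mathcomp Require Import measurable_realfun.
From mathcomp Require Import ring lra.

(** A point [x] lies outside the half-space of a uniform [v] when [v] falls in the
    lens [2 <x,v> > |v|^2] of the unit ball.  Up to [exp (o(d))] this lens has the
    volume of the smallest ball containing it, whose squared radius is [r^2] if
    [r = |x|] satisfies [r^2 <= 1/2] and [1 - 1/(4 r^2)] otherwise: most of that ball
    is concentrated near the hyperplane orthogonal to [x] through its center, and that
    part is in the lens when the radius is slightly decreased.  In both regimes of the
    theorem [sqrt c] is the value of [r] at which [n] times the probability of the
    lens crosses 1.

    Below that value the union bound and Tonelli show that the cell misses only a
    small part of the ball of radius [r] on average.  Above it, independence makes the
    expected volume of the cell within a shell doubly exponentially small.  The cell
    is convex and with high probability contains a ball of constant radius around the
    origin, so reaching beyond the shell would force it to contain a ball of constant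
    radius inside the shell; Markov's inequality excludes this. *)

Import Order.TTheory GRing.Theory Num.Theory.
Import numFieldNormedType.Exports.

Local Open Scope classical_set_scope.
Local Open Scope ring_scope.

(** * Affine invariance of the Lebesgue measure *)

Section affine1.
Context {R : realType}.
Implicit Types (a s : R).
Local Notation mu := (@lebesgue_measure R).

Definition affine1 a s (x : measurableTypeR R) : measurableTypeR R :=
  ((x : R) - a) / s.

Lemma measurable_affine1 a s : measurable_fun setT (affine1 a s).
Proof. by apply: measurable_funM => //; exact: measurable_funB. Qed.

Lemma affine1_preimage_itvoc a s (u v : R) : 0 < s ->
  affine1 a s @^-1` `]u, v]%classic = `]u * s + a, v * s + a]%classic.
Proof.
move=> s0; apply/seteqP; split=> x; rewrite /affine1/= !in_itv/=.
  by rewrite ltr_pdivlMr// ler_pdivrMr// ltrBrDr lerBlDr.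
by rewrite ltr_pdivlMr// ler_pdivrMr// ltrBrDr lerBlDr.
Qed.

(** The right-hand side is itself a measure in [A] and agrees with length on half-open intervals, so
    uniqueness of the Lebesgue measure applies. *)
Lemma lebesgue_measure_affine1 a s (A : set (measurableTypeR R)) : 0 < s ->
  measurable A ->
  mu A = ((s^-1)%:E * mu (affine1 a s @^-1` A))%E.
Proof.
move=> s0 mA.
pose k : {nonneg R} := (NngNum (ltW (divr_gt0 ltr01 s0))).
pose pf : {measure set (measurableTypeR R) -> \bar R} :=
  measure_function_pushforward__canonical__measure_function_Measure
    mu (measurable_affine1 a s).
rewrite (@lebesgue_measure_unique _ (mscale k pf)) //=.
  by rewrite /mscale/= /pushforward div1r.
move=> _ [[u v]] _ <-; rewrite /mscale/= /pushforward affine1_preimage_itvoc//.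
rewrite !lebesgue_measure_itv/= !lte_fin ltrD2r ltr_pM2r//.
case: ifPn => _; last by rewrite mule0.
rewrite -!EFinD -EFinM; congr EFin; field; lra.
Qed.

Lemma ge0_integral_affine1 a s (g : measurableTypeR R -> \bar R) : 0 < s ->
  measurable_fun setT g -> (forall x, 0 <= g x)%E ->
  (\int[mu]_x g (affine1 a s x) = s%:E * \int[mu]_x g x)%E.
Proof.
move=> s0 mg g0.
pose k : {nonneg R} := (NngNum (ltW (divr_gt0 ltr01 s0))).
pose pf : {measure set (measurableTypeR R) -> \bar R} :=
  measure_function_pushforward__canonical__measure_function_Measure
    mu (measurable_affine1 a s).
have -> : (\int[mu]_x g x = \int[mscale k pf]_x g x)%E.
  apply: eq_measure_integral => A mA _.
  by rewrite /= /mscale/= /pushforward div1r; exact: lebesgue_measure_affine1.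
rewrite ge0_integral_mscale//= ge0_integral_pushforward//=; last first.
  exact: measurable_affine1.
by rewrite muleA -EFinM mulrC div1r mulVf ?gt_eqF// mul1e.
Qed.

End affine1.

Section affine.
Context {R : realType}.

Definition affine d (a : euclid R d) (s : R) (x : euclid R d) : euclid R d :=
  [tuple affine1 (tnth a i) s (tnth x i) | i < d].

Lemma affine_cons d (a : euclid R d.+1) s p :
  affine d.+1 a s (consp p) =
  consp (affine1 (thead a) s p.1, affine d [tuple of behead a] s p.2).
Proof.
apply: eq_from_tnth => i; rewrite tnth_mktuple.
case: (unliftP ord0 i) => [j ->|->].
  by rewrite !tnthS tnth_mktuple; congr affine1; rewrite tnth_behead; congr tnth;
    apply: val_inj => /=; rewrite inordK// ltnS.
by rewrite !tnth0.
Qed.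

Lemma lebesgue_tuple_recl d (A : set (euclid R d.+1)) :
  lebesgue_tuple d.+1 A =
  (\int[lebesgue_measure]_x lebesgue_tuple d (xsection (@consp R d @^-1` A) x))%E.
Proof. by []. Qed.

(** Cavalieri and induction on [d]: a section of the preimage is the preimage of a section, so the
    inner measure contributes [s ^+ d] and the substitution in the outer integral one more [s]. *)
Lemma lebesgue_tuple_affine d (a : euclid R d) s (A : set (euclid R d)) :
  0 < s -> measurable A ->
  lebesgue_tuple d (affine d a s @^-1` A) = ((s ^+ d)%:E * lebesgue_tuple d A)%E.
Proof.
move=> s0; elim: d a A => [|d IH] a A mA.
  by rewrite expr0 mul1e; congr (lebesgue_tuple 0 _); apply/seteqP; split=> x /=;
    rewrite (tuple0 (affine _ _ _ _)) (tuple0 x).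
have mA' : measurable (@consp R d @^-1` A).
  by rewrite -[X in measurable X]setTI; exact: measurable_consp.
have mAx x : measurable (xsection (@consp R d @^-1` A) x).
  exact: measurable_xsection.
rewrite !lebesgue_tuple_recl.
under eq_integral => x _.
  rewrite (_ : xsection _ _ = affine d [tuple of behead a] s @^-1`
     (xsection (@consp R d @^-1` A) (affine1 (thead a) s x))); last first.
    apply/seteqP; split=> y; rewrite /xsection/= !inE/= affine_cons//.
  rewrite IH//.
  over.
rewrite ge0_integralZl//=; last 2 first.
- have := @measurable_fun_xsection _ _ _ _ _ (lebesgue_tuple d) _ mA'.
  move=> h; exact: (measurableT_comp h (measurable_affine1 _ _)).
- by rewrite lee_fin exprn_ge0// ltW.
have mh := @measurable_fun_xsection _ _ _ _ _ (lebesgue_tuple d) _ mA'.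
rewrite (ge0_integral_affine1 (thead a) s
  (fun x => lebesgue_tuple d (xsection (@consp R d @^-1` A) x)))//.
by rewrite muleA -EFinM -exprSr.
Qed.

End affine.

(** * Balls and lenses *)

Section dot.
Context {R : realType} {d : nat}.
Implicit Types (x y z v a : euclid R d) (s t : R).

Definition dot x y : R := \sum_(i < d) (tnth x i : R) * (tnth y i : R).

Definition escale t x : euclid R d :=
  [tuple (t * (tnth x i : R) : measurableTypeR R) | i < d].

Lemma dotC x y : dot x y = dot y x.
Proof. by apply: eq_bigr => i _; rewrite mulrC. Qed.

Lemma dot_ge0 x : 0 <= dot x x.
Proof. by apply: sumr_ge0 => i _; rewrite -expr2 sqr_ge0. Qed.

Lemma dotZr t x y : dot x (escale t y) = t * dot x y.
Proof.
by rewrite /dot mulr_sumr; apply: eq_bigr => i _; rewrite tnth_mktuple mulrCA.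
Qed.

Lemma dotZl t x y : dot (escale t x) y = t * dot x y.
Proof. by rewrite dotC dotZr dotC. Qed.

Lemma dotBl x y z : dot (esub x y) z = dot x z - dot y z.
Proof.
by rewrite /dot -sumrB; apply: eq_bigr => i _; rewrite tnth_mktuple mulrBl.
Qed.

Lemma dotBr x y z : dot z (esub x y) = dot z x - dot z y.
Proof. by rewrite dotC dotBl !(dotC z). Qed.

Lemma enormE x : enorm x = Num.sqrt (dot x x).
Proof. by congr Num.sqrt; apply: eq_bigr => i _; rewrite expr2. Qed.

Lemma unit_ballE : unit_ball = [set x | dot x x <= 1].
Proof.
have e x : (Num.sqrt (dot x x) <= 1) = (dot x x <= 1).
  by rewrite -[X in _ <= X]sqrtr1 ler_sqrt// ?ler01// sqrtr1.
by apply/seteqP; split => x; rewrite /unit_ball /= enormE e.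
Qed.

Lemma halfspaceE v x : halfspace v x <-> 2 * dot x v <= dot v v.
Proof.
rewrite /halfspace/= !enormE ler_sqrt ?dot_ge0// dotBl !dotBr (dotC v x).
by split=> h; lra.
Qed.

Lemma measurable_dot dp (T : measurableType dp) (f g : T -> euclid R d) :
  measurable_fun setT f -> measurable_fun setT g ->
  measurable_fun setT (fun p => dot (f p) (g p)).
Proof.
have mt i : measurable_fun [set: euclid R d] (fun x => tnth x i).
  exact: measurable_tnth.
move=> mf mg; apply: measurable_sum => i; apply: measurable_funM.
  exact: (measurableT_comp (mt i) mf).
exact: (measurableT_comp (mt i) mg).
Qed.

Lemma measurable_dotl y : measurable_fun setT (fun x => dot x y).
Proof. exact: measurable_dot. Qed.

Lemma measurable_dotxx : measurable_fun setT (fun x => dot x x).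
Proof. exact: measurable_dot. Qed.

End dot.

Section sublevel.
Context {R : realType} dp (T : measurableType dp).
Variables f g : T -> R.
Hypotheses (mf : measurable_fun setT f) (mg : measurable_fun setT g).

Lemma measurable_set_ler : measurable [set x | f x <= g x].
Proof.
have := measurable_fun_ler mf mg => /(_ measurableT [set true]).
by rewrite setTI; apply.
Qed.

Lemma measurable_set_ltr : measurable [set x | f x < g x].
Proof.
have := measurable_fun_ltr mf mg => /(_ measurableT [set true]).
by rewrite setTI; apply.
Qed.

End sublevel.

Section eball.
Context {R : realType} {d : nat}.
Implicit Types (x y z v a : euclid R d) (s t : R).

(** The condition |x - a|^2 <= s^2 is kept expanded in inner products, so that later inclusions
    reduce to polynomial arithmetic. *)
Definition eball a s : set (euclid R d) :=
  [set x | dot x x - 2 * dot x a + dot a a <= s ^+ 2].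

Lemma measurable_eball a s : measurable (eball a s).
Proof.
apply: measurable_set_ler => //; apply: measurable_funD => //.
apply: measurable_funB; first exact: measurable_dotxx.
by apply: measurable_funM => //; exact: measurable_dotl.
Qed.

Lemma measurable_unit_ball : measurable (@unit_ball R d).
Proof.
by rewrite unit_ballE; apply: measurable_set_ler => //; exact: measurable_dotxx.
Qed.

Lemma eball_affine a s : 0 < s -> eball a s = affine d a s @^-1` unit_ball.
Proof.
move=> s0; have e x : dot (affine d a s x) (affine d a s x) =
    (dot x x - 2 * dot x a + dot a a) / s ^+ 2.
  rewrite /dot mulr_sumr -sumrB -big_split/= mulr_suml; apply: eq_bigr => i _.
  rewrite tnth_mktuple /affine1; field; lra.
rewrite unit_ballE; apply/seteqP; split => x; rewrite /eball/= e.
  by rewrite ler_pdivrMr ?exprn_gt0// mul1r.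
by rewrite ler_pdivrMr ?exprn_gt0// mul1r.
Qed.

Lemma measurable_box (A : 'I_d -> set (measurableTypeR R)) :
  (forall i, measurable (A i)) ->
  measurable [set x : euclid R d | forall i, A i (tnth x i)].
Proof.
move=> mA.
rewrite (_ : [set _ | _] = \bigcap_(i in [set: 'I_d])
    (fun x : euclid R d => tnth x i) @^-1` A i); last first.
  by apply/seteqP; split => [x Bx i _|x Bx i]; [exact: Bx|exact: (Bx i)].
apply: fin_bigcap_measurable => // i _.
by rewrite -[X in measurable X]setTI; exact: measurable_tnth.
Qed.

Definition ball_vol : R := fine (lebesgue_tuple d (@unit_ball R d)).

Lemma lebesgue_unit_ball_gt0 : (0 < lebesgue_tuple d (@unit_ball R d))%E.
Proof.
(* Half-side of a cube inside the ball: as [q <= 1], squared coordinates are at most [q] and sum to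
   at most [d * q <= 1]. The successor covers [d = 0]. *)
set q : R := d.+1%:R^-1.
have q0 : 0 < q by rewrite invr_gt0.
pose A (i : 'I_d) : set (measurableTypeR R) := `[- q, q]%classic.
have mA i : measurable (A i) by exact: measurable_itv.
apply: (@lt_le_trans _ _ (lebesgue_tuple d [set x | forall i, A i (tnth x i)])).
  rewrite lebesgue_tuple_box//.
  rewrite (eq_bigr (fun=> (q + q)%:E)); last first.
    move=> i _; rewrite /A lebesgue_measure_itv/= lte_fin ifT; last by lra.
    by rewrite -EFinD opprK.
  by rewrite prodEFin lte_fin prodr_gt0// => i _; rewrite addr_gt0.
apply: le_measure; rewrite ?inE//; [exact: measurable_box|exact: measurable_unit_ball|].
move=> x Ax; rewrite unit_ballE/=.
apply: (@le_trans _ _ (\sum_(i < d) q)).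
  apply: ler_sum => i _; have := Ax i; rewrite /A/= in_itv/= => /andP[h1 h2].
  have q1 : q <= 1 by rewrite invf_le1// ler1n.
  nra.
rewrite sumr_const card_ord /q -[X in X <= _]mulr_natl ler_pdivrMr// mul1r.
by rewrite ler_nat.
Qed.

Lemma lebesgue_unit_ball_lty : (lebesgue_tuple d (@unit_ball R d) < +oo)%E.
Proof.
pose A (i : 'I_d) : set (measurableTypeR R) := `[- 1, 1]%classic.
have mA i : measurable (A i) by exact: measurable_itv.
apply: (@le_lt_trans _ _ (lebesgue_tuple d [set x | forall i, A i (tnth x i)])).
  apply: le_measure; rewrite ?inE//;
    [exact: measurable_unit_ball|exact: measurable_box|].
  move=> x; rewrite unit_ballE/= => x1 i; rewrite /A/= in_itv/=.
  have : (tnth x i : R) * tnth x i <= 1.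
    apply: le_trans x1; rewrite /dot (bigD1 i)//= lerDl.
    by apply: sumr_ge0 => j _; rewrite -expr2 sqr_ge0.
  by move=> h; apply/andP; split; nra.
rewrite lebesgue_tuple_box//.
rewrite (eq_bigr (fun=> (1 + 1)%:E)) ?prodEFin ?ltry//.
move=> i _; rewrite /A lebesgue_measure_itv/= lte_fin ifT; last by lra.
by rewrite -EFinD opprK.
Qed.

Lemma lebesgue_unit_ball : lebesgue_tuple d (@unit_ball R d) = ball_vol%:E.
Proof. by rewrite fineK// ge0_fin_numE ?lebesgue_unit_ball_lty. Qed.

Lemma ball_vol_gt0 : 0 < ball_vol.
Proof. by rewrite -lte_fin -lebesgue_unit_ball lebesgue_unit_ball_gt0. Qed.

Lemma lebesgue_eball a s : 0 < s ->
  lebesgue_tuple d (eball a s) = (s ^+ d * ball_vol)%:E.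
Proof.
move=> s0; rewrite eball_affine// lebesgue_tuple_affine//.
  by rewrite lebesgue_unit_ball.
exact: measurable_unit_ball.
Qed.

End eball.
Arguments ball_vol R d : clear implicits.

Section lens.
Context {R : realType} {d : nat}.
Implicit Types (x y z v a : euclid R d) (r s t : R).

Definition lens x : set (euclid R d) :=
  [set v | dot v v < 2 * dot x v] `&` unit_ball.

Lemma measurable_not_halfspace x : measurable [set v | dot v v < 2 * dot x v].
Proof.
apply: measurable_set_ltr; first exact: measurable_dotxx.
by apply: measurable_funM => //; exact: measurable_dot.
Qed.

Lemma measurable_lens x : measurable (lens x).
Proof.
exact: measurableI (measurable_not_halfspace x) measurable_unit_ball.
Qed.

(** The lens lies in the ball of radius [s] centered on the ray of [x] at distance [t]. If [t = r],
    the inequality defining the lens suffices; if [2 r t = 1], it is combined with |v|^2 <= 1, with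
    weights [t / r] and [1 - t / r]. *)
Lemma lens_volume_le x r t s : 0 < t -> t <= r -> 0 < s ->
  t = r \/ 2 * r * t = 1 -> s ^+ 2 = 2 * r * t - t ^+ 2 ->
  dot x x <= r ^+ 2 -> (lebesgue_tuple d (lens x) <= (s ^+ d * ball_vol R d)%:E)%E.
Proof.
move=> t0 tr s0 ht hs hx.
set rho := Num.sqrt (dot x x).
have rho2 : rho ^+ 2 = dot x x by rewrite sqr_sqrtr// dot_ge0.
have rho0 : 0 <= rho by exact: sqrtr_ge0.
rewrite -(@lebesgue_eball R d (escale (t / rho) x))//.
apply: le_measure; rewrite ?inE//.
- exact: measurable_lens.
- exact: measurable_eball.
move=> v [/= h1]; rewrite unit_ballE/= => h2; rewrite /eball/= !dotZr !dotZl -rho2.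
have vv0 := dot_ge0 v.
have dxv : dot v x = dot x v by rewrite dotC.
(* For [x = 0] the lens is empty, so the default value of [t / rho] does no harm. *)
have rho_gt0 : 0 < rho.
  rewrite lt_neqAle rho0 andbT eq_sym; apply/eqP => rho00.
  have : dot x x = 0 by rewrite -rho2 rho00 expr0n.
  move=> /eqP; rewrite /dot psumr_eq0; last by move=> i _; rewrite -expr2 sqr_ge0.
  move=> /allP h; move: h1; rewrite /dot [X in 2 * X]big1 ?mulr0.
    by rewrite ltNge vv0.
  move=> i _; have := h i (mem_index_enum _).
  by rewrite /= mulf_eq0 orbb => /eqP ->; rewrite mul0r.
have rhor : rho <= r.
  have r0 : 0 <= r by lra.
  by rewrite -(ler_pXn2r (n := 2)) ?nnegrE// rho2.
pose a := dot v x / rho.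
have ax : dot v x = a * rho by rewrite /a; field; lra.
have va : dot v v <= 2 * r * a.
  apply: (le_trans (ltW h1)); rewrite -dxv ax.
  have a0 : 0 <= a.
    rewrite /a divr_ge0// dxv.
    by lra.
  nra.
have -> : 2 * (t / rho * dot v x) = 2 * t * a by rewrite /a; field; lra.
have -> : t / rho * (t / rho * rho ^+ 2) = t ^+ 2 by field; lra.
rewrite hs; case: ht => h.
  rewrite h; nra.
nra.
Qed.

(** Up to a thin slab nothing of a slightly shrunken ball needs to be in the lens: since [s' < s],
    the loss [2 * s' ^+ d] is exponentially smaller than [s ^+ d]. *)
Lemma lens_volume_ge x r t s s' eta : 0 < eta -> eta <= t -> 0 < s' ->
  s' ^+ 2 = s ^+ 2 - eta ^+ 2 -> 0 < s ->
  2 * r * t <= 1 -> t ^+ 2 + s ^+ 2 + 2 * (t + r) * eta < 2 * r * t ->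
  0 < r -> r ^+ 2 <= dot x x ->
  (((s ^+ d - 2 * s' ^+ d) * ball_vol R d)%:E <= lebesgue_tuple d (lens x))%E.
Proof.
move=> eta0 etat s'0 s'E s0 rt1 rt r0 hx.
set rho := Num.sqrt (dot x x).
have rho2 : rho ^+ 2 = dot x x by rewrite sqr_sqrtr// dot_ge0.
have rho_ge0 : 0 <= rho by exact: sqrtr_ge0.
have rrho : r <= rho by rewrite -(ler_pXn2r (n := 2)) ?nnegrE ?rho2// ltW.
have rho0 : 0 < rho by lra.
pose B k q : set (euclid R d) := eball (escale (k / rho) x) q.
(* Outside the slab of half-width [eta] around its center hyperplane, the ball of
   radius [s] is covered by two balls of the smaller radius [s']. *)
have sub : B t s `<=` lens x `|` (B (t + eta) s' `|` B (t - eta) s').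
  move=> v; rewrite /B /eball/= !dotZr !dotZl -rho2 s'E.
  pose a := dot v x / rho.
  have ax k : 2 * (k / rho * dot v x) = 2 * k * a by rewrite /a; field; lra.
  have rk k : k / rho * (k / rho * rho ^+ 2) = k ^+ 2 by field; lra.
  rewrite !ax !rk => h.
  (* Beyond the slab, shifting the center by [eta] to the side of [v] lowers the squared distance by
     at least [eta ^+ 2]. *)
  have [h1|h1] := ltP (t + eta) a; first by right; left; nra.
  have [h2|h2] := ltP a (t - eta); first by right; right; nra.
  (* Inside the slab, |v|^2 <= s^2 + t^2 + 2 t eta < 2 r (t - eta) <= 2 r a; moreover 2 r (t - eta)
     <= 2 r t <= 1, which gives the unit ball. *)
  left; split => /=; last by rewrite unit_ballE/=; nra.
  rewrite (dotC x v) (_ : dot v x = a * rho); last by rewrite /a; field; lra.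
  have : dot v v < 2 * r * a by nra.
  have : 0 <= a by lra.
  nra.
have mB k q : measurable (B k q) by exact: measurable_eball.
have mL := measurable_lens x.
have := @le_measure _ _ _ (lebesgue_tuple d) (B t s) _ _ _ sub.
rewrite !inE => /(_ (mB _ _)).
move=> /(_ (measurableU _ _ mL (measurableU _ _ (mB _ _) (mB _ _)))).
move=> h1.
have h2 : (lebesgue_tuple d (B t s) <=
    lebesgue_tuple d (lens x) + (2 * s' ^+ d * ball_vol R d)%:E)%E.
  apply: (le_trans h1); apply: (le_trans (measureU2 _ _ _)) => //.
    exact: measurableU.
  apply: leeD => //; apply: (le_trans (measureU2 _ _ _)) => //.
  have vB k : (lebesgue_tuple d (B k s') <= (s' ^+ d * ball_vol R d)%:E)%E.
    by rewrite /B lebesgue_eball.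
  apply: (le_trans (leeD (vB _) (vB _))).
  by rewrite -EFinD lee_fin; lra.
rewrite /B lebesgue_eball// in h2.
by rewrite mulrBl EFinB leeBlDr.
Qed.

End lens.

(** * The random Voronoi cell *)

Lemma measure_bigU_le (R : realType) dp (T : measurableType dp)
    (mu : {measure set T -> \bar R}) (I : Type) (s : seq I) (A : I -> set T) :
  (forall i, measurable (A i)) ->
  (mu (\big[setU/set0]_(i <- s) A i) <= \sum_(i <- s) mu (A i))%E.
Proof.
move=> mA; elim: s => [|i s IH]; first by rewrite !big_nil measure0.
rewrite !big_cons; apply: (le_trans (measureU2 _ _ _)) => //.
  by apply: bigsetU_measurable.
exact: leeD.
Qed.

(** Markov's inequality for the random volume of a section within [S]. By Tonelli its expectation is
    the integral over [S] of the pointwise probabilities, each at most [b]. It serves both the cell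
    and its complement. *)
Lemma markov_xsection (R : realType) dp1 dp2 (T1 : measurableType dp1)
    (T2 : measurableType dp2) (P : probability T1 R)
    (mu : {sigma_finite_measure set T2 -> \bar R}) (G : set (T1 * T2))
    (S : set T2) (E : set T1) (b tau : R) :
  measurable G -> measurable S -> measurable E -> 0 < tau ->
  (forall y, S y -> (P (ysection G y) <= b%:E)%E) ->
  (forall w, E w -> (tau%:E <= mu (xsection G w `&` S))%E) ->
  (tau%:E * P E <= b%:E * mu S)%E.
Proof.
move=> mG mS mE tau0 hb hE.
pose G' := G `&` (setT `*` S).
have mG' : measurable G' by apply: measurableI => //; exact: measurableX.
have xG' w : xsection G' w = xsection G w `&` S.
  by apply/seteqP; split=> y; rewrite /xsection/= !inE /G' /= => -[? //] [].
have mF := @measurable_fun_xsection _ _ _ _ _ mu _ mG'.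
have h := le_integral_abse P measurableT mF tau0.
apply: (@le_trans _ _ (tau%:E *
    P ([set: T1] `&` [set x | (tau%:E <= `|(mu \o xsection G') x|)%E])))%E.
  rewrite lee_pmul2l ?lte_fin//; apply: le_measure; rewrite ?inE//.
    by apply: emeasurable_fun_c_infty => //; exact: measurableT_comp.
  by move=> w Ew; split => //=; rewrite gee0_abs// xG'; exact: hE.
apply: (le_trans h).
under eq_integral do rewrite gee0_abs//.
have := indic_fubini_tonelli P mu mG'.
rewrite indic_fubini_tonelli_FE// indic_fubini_tonelli_GE// => ->.
(* Off [S] the sections of [G'] are empty, which turns the integral over the whole space into one
   over [S]. *)
have yG' y : ysection G' y = if y \in S then ysection G y else set0.
  apply/seteqP; split=> w; rewrite /ysection/= ?inE /G'.
    move=> [Gw [_ /= Sy]]; rewrite mem_set//=; rewrite inE//.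
  case: ifPn => // /set_mem Sy /=; rewrite inE//.
have -> : (\int[mu]_x (P \o ysection G') x = \int[mu]_(x in S) P (ysection G x))%E.
  rewrite [RHS]integral_mkcond; apply: eq_integral => y _ /=.
  by rewrite patchE yG'; case: ifPn => //; rewrite measure0.
rewrite -[X in (_ <= X)%E](integral_cst mu mS).
apply: ge0_le_integral => //.
  exact/measurable_funTS/measurable_fun_ysection.
Qed.

(** Expand |k u - v|^2 >= 0 and divide by [k]. *)
Lemma dot_amgm (R : realType) d (u v : euclid R d) (k : R) : 0 < k ->
  2 * dot u v <= k * dot u u + dot v v / k.
Proof.
move=> k0; have := dot_ge0 (esub (escale k u) v).
rewrite dotBl !dotBr !dotZl !dotZr (dotC v u) => h.
rewrite -(ler_pM2r k0).
rewrite [leRHS](_ : _ = k ^+ 2 * dot u u + dot v v); last by field; lra.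
rewrite expr2; lra.
Qed.

Section voronoi_random.
Context {R : realType} {disp : measure_display} {Om : measurableType disp}.
Variables (P : probability Om R) (d n : nat) (X : 'I_n -> {RV P >-> euclid R d}).
Hypothesis Xunif : forall i, uniform_in unit_ball (X i).
Hypothesis Xindep : mutually_independent X.
Implicit Types (x y z v : euclid R d) (w : Om).
Local Notation vol := (lebesgue_tuple d).
Local Notation bv := (ball_vol R d).

Definition cell w : set (euclid R d) := voronoi (range (fun i => X i w)).

Definition cell_graph : set (Om * euclid R d) := [set p | cell p.1 p.2].

Lemma cellE w x : cell w x <-> forall i, 2 * dot x (X i w) <= dot (X i w) (X i w).
Proof.
split=> [h i|h _ [i _ <-]]; last exact/halfspaceE.
by apply/halfspaceE; apply: h; exists i.
Qed.

(** Tonelli needs measurability jointly in sample and point; measurability of each cell and of its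
    volume then follows by taking sections. *)
Lemma measurable_cell_graph : measurable cell_graph.
Proof.
rewrite (_ : cell_graph = \bigcap_(i in [set: 'I_n])
   [set p : Om * euclid R d |
     2 * dot p.2 (X i p.1) <= dot (X i p.1) (X i p.1)]); last first.
  by apply/seteqP; split => p; rewrite /cell_graph/= cellE; [move=> h i _|move=> h i];
    exact: h.
have mX i : measurable_fun setT (fun p : Om * euclid R d => X i p.1).
  by apply: measurableT_comp => //; exact: measurable_fst.
apply: fin_bigcap_measurable => // i _; apply: measurable_set_ler.
  by apply: measurable_funM => //; apply: measurable_dot.
exact: measurable_dot.
Qed.

Lemma xsection_cell w : xsection cell_graph w = cell w.
Proof. by apply/seteqP; split => x; rewrite /xsection/= inE. Qed.

Lemma measurable_cell w : measurable (cell w).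
Proof.
by rewrite -xsection_cell; apply: measurable_xsection; exact: measurable_cell_graph.
Qed.

Lemma measurable_cell_vol : measurable_fun setT (fun w => vol (cell w)).
Proof.
have := @measurable_fun_xsection _ _ _ _ _ vol _ measurable_cell_graph.
by congr measurable_fun; apply/funext => w /=; rewrite xsection_cell.
Qed.

Lemma prob_uniform i (A : set (euclid R d)) : measurable A ->
  P (X i @^-1` A) = (vol (A `&` unit_ball) * (bv^-1)%:E)%E.
Proof.
move=> mA; have := Xunif i A mA; rewrite /distribution /pushforward => ->.
by rewrite lebesgue_unit_ball inver gt_eqF// ball_vol_gt0.
Qed.

Lemma prob_uniform_le i (A : set (euclid R d)) (q : R) : measurable A ->
  (vol (A `&` unit_ball) <= (q * bv)%:E)%E -> (P (X i @^-1` A) <= q%:E)%E.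
Proof.
move=> mA h; rewrite prob_uniform//.
apply: (@le_trans _ _ ((q * bv)%:E * (bv^-1)%:E)%E).
  by apply: lee_pmul => //; rewrite lee_fin invr_ge0 ltW// ball_vol_gt0.
by rewrite -EFinM mulfK// gt_eqF// ball_vol_gt0.
Qed.

Lemma prob_uniform_ge i (A : set (euclid R d)) (q : R) : measurable A ->
  ((q * bv)%:E <= vol (A `&` unit_ball))%E -> (q%:E <= P (X i @^-1` A))%E.
Proof.
move=> mA h; rewrite prob_uniform//.
by rewrite lee_pdivlMr ?ball_vol_gt0// -EFinM.
Qed.

Lemma measurable_preX i (A : set (euclid R d)) : measurable A ->
  measurable (X i @^-1` A).
Proof. by move=> mA; rewrite -[X in measurable X]setTI; exact: measurable_funP. Qed.

Lemma prob_exists_le (A : set (euclid R d)) (q : R) : measurable A ->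
  (vol (A `&` unit_ball) <= (q * bv)%:E)%E ->
  (P (\big[setU/set0]_(i < n) (X i @^-1` A)) <= (n%:R * q)%:E)%E.
Proof.
move=> mA h; apply: le_trans.
  by apply: measure_bigU_le => i; exact: measurable_preX.
apply: (@le_trans _ _ (\sum_(i < n) q%:E)%E).
  by apply: lee_sum => i _; exact: prob_uniform_le.
by rewrite sumEFin sumr_const card_ord mulr_natl.
Qed.

Lemma prob_notin_cell_le x q : (vol (lens x) <= (q * bv)%:E)%E ->
  (P (ysection (~` cell_graph) x) <= (n%:R * q)%:E)%E.
Proof.
move=> h.
rewrite (_ : ysection _ _ = \big[setU/set0]_(i < n)
    (X i @^-1` [set v | dot v v < 2 * dot x v])).
  by apply: prob_exists_le => //; exact: measurable_not_halfspace.
rewrite -bigcup_seq; apply/seteqP; split => w; rewrite /ysection/= inE /cell_graph/=.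
  move=> /cellE /existsNP[i /negP]; rewrite -ltNge => hi.
  by exists i => //=; rewrite mem_index_enum.
move=> [i _ /= hi] /cellE /(_ i); by rewrite leNgt hi.
Qed.

(** By independence all [n] vectors avoid the lens with probability at most (1 - q)^n, and 1 - q <=
    exp (- q). *)
Lemma prob_in_cell_le x q : 0 <= q ->
  ((q * bv)%:E <= vol (lens x))%E ->
  (P (ysection cell_graph x) <= (expR (- (n%:R * q)))%:E)%E.
Proof.
move=> q0 h.
pose A := [set v | dot v v < 2 * dot x v].
have mA : measurable A by exact: measurable_not_halfspace.
rewrite (_ : ysection _ _ =
    \bigcap_(i in [set` [set: 'I_n]%SET]) (X i @^-1` (~` A))); last first.
  apply/seteqP; split => w; rewrite /ysection/= inE /cell_graph/=.
    by move=> /cellE hw i _ /=; rewrite /A/=; apply/negP; rewrite -leNgt.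
  move=> hw; apply/cellE => i; rewrite leNgt; apply/negP.
  by apply: (hw i); rewrite /= inE.
rewrite Xindep; last by move=> i; exact: measurableC.
rewrite big_mkcond/=.
apply: (@le_trans _ _ (\prod_(i < n) (expR (- q))%:E)%E); last first.
  rewrite prodEFin lee_fin prodr_const card_ord -mulrN expRM_natl//.
(* Nonnegativity is carried through the product, since inequalities multiply only between
   nonnegative factors. *)
apply: (@proj2 (0%R <= _)%E).
apply: (big_ind2 (fun a b : \bar R => (0 <= a)%E /\ (a <= b)%E)).
- by [].
- by move=> a b a' b' [? ?] [? ?]; split; [exact: mule_ge0|apply: lee_pmul].
move=> i _; rewrite inE; split => //.
rewrite -preimage_setC probability_setC; last exact: measurable_preX.
have hq := prob_uniform_ge i A q mA h.
apply: (@le_trans _ _ (1 - q%:E)%E); first exact: leeB.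
by rewrite -EFinB lee_fin; have := expR_ge1Dx (- q).
Qed.


Let origin : euclid R d := [tuple (0 : measurableTypeR R) | i < d].

Let eball0E r : eball origin r = [set x : euclid R d | dot x x <= r ^+ 2].
Proof.
have e x : dot x origin = 0.
  by rewrite /dot big1// => i _; rewrite tnth_mktuple mulr0.
by apply/seteqP; split => x; rewrite /eball/= !e; rewrite mulr0 subr0 addr0.
Qed.

Lemma lebesgue_ball0 r : 0 < r ->
  vol [set x : euclid R d | dot x x <= r ^+ 2] = (r ^+ d * bv)%:E.
Proof. by move=> r0; rewrite -eball0E lebesgue_eball. Qed.

Lemma measurable_ball0 r : measurable [set x : euclid R d | dot x x <= r ^+ 2].
Proof. by rewrite -eball0E; exact: measurable_eball. Qed.

Lemma measurable_cell_vol_lt (a : \bar R) : measurable [set w | (vol (cell w) < a)%E].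
Proof.
rewrite -[X in measurable X]setTI; apply: emeasurable_fun_infty_o => //.
exact: measurable_cell_vol.
Qed.

Lemma measurable_cell_vol_gt (a : \bar R) : measurable [set w | (a < vol (cell w))%E].
Proof.
rewrite -[X in measurable X]setTI; apply: emeasurable_fun_o_infty => //.
exact: measurable_cell_vol.
Qed.

(** Each point of the ball of radius [r] is missed with probability at most [n * s ^+ d]. A cell
    with less than half the volume of this ball misses at least half of it, so Markov's inequality
    costs a factor 2. *)
Lemma prob_cell_vol_lt (r t s : R) : 0 < t -> t <= r -> 0 < s ->
  t = r \/ 2 * r * t = 1 -> s ^+ 2 = 2 * r * t - t ^+ 2 ->
  (P [set w | (vol (cell w) < (r ^+ d * bv / 2)%:E)%E] <= (2 * (n%:R * s ^+ d))%:E)%E.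
Proof.
move=> t0 tr s0 ht hs.
have r0 : 0 < r by lra.
set tau := r ^+ d * bv / 2.
have tau0 : 0 < tau by rewrite divr_gt0// mulr_gt0 ?ball_vol_gt0// exprn_gt0.
pose S : set (euclid R d) := [set x : euclid R d | dot x x <= r ^+ 2].
have mS : measurable S by exact: measurable_ball0.
have mG := measurable_cell_graph.
have mGC : measurable (~` cell_graph) by exact: measurableC.
have hb x : S x -> (P (ysection (~` cell_graph) x) <= (n%:R * s ^+ d)%:E)%E.
  by move=> Sx; apply: prob_notin_cell_le; exact: (lens_volume_le x r t s).
have xs w : xsection (~` cell_graph) w = ~` cell w.
  by rewrite -xsection_cell; apply/seteqP; split=> x; rewrite /xsection/= !inE.
rewrite -(@lee_pmul2l _ tau%:E) ?lte_fin//.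
rewrite (_ : _ * (2 * _)%:E = (n%:R * s ^+ d)%:E * vol S)%E; last first.
  by rewrite lebesgue_ball0// -!EFinM /tau; congr EFin; field.
apply: (markov_xsection _ _ _ _ _ P vol (~` cell_graph)) => //.
  exact: measurable_cell_vol_lt.
move=> w /= hw; rewrite leNgt; apply/negP; rewrite xs => hw2.
have : (vol S < (tau + tau)%:E)%E.
  apply: le_lt_trans (lteD hw hw2); apply: le_trans (measureU2 _ _ _).
  - apply: le_measure; rewrite ?inE//.
    + apply: measurableU; first exact: measurable_cell.
      by apply: measurableI => //; apply: measurableC; exact: measurable_cell.
    + by move=> x Sx; have [|] := pselect (cell w x); [left|right].
  - exact: measurable_cell.
  - by apply: measurableI => //; apply: measurableC; exact: measurable_cell.
rewrite lebesgue_ball0// lte_fin /tau; lra.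
Qed.


(* By convexity the cell contains the cone over a small ball around the origin
   with apex [z], hence a ball of fixed radius inside the shell [r1 <= |y| <= K]. *)
Lemma cell_shell_volume w z (m lam r1 r2 K : R) :
  0 < m -> 0 < lam -> lam < 1 -> 0 < r2 ->
  2 * r2 ^+ 2 + 2 * (lam * m / 2) ^+ 2 <= K ^+ 2 ->
  r1 ^+ 2 <= (1 - lam) ^+ 2 * r2 ^+ 2 - (lam * m / 2) * (r2 ^+ 2 + 1) ->
  (forall i, m ^+ 2 <= dot (X i w) (X i w)) ->
  cell w z -> r2 ^+ 2 < dot z z ->
  (((lam * m / 2) ^+ d * bv)%:E <=
    vol (cell w `&` [set y | r1 ^+ 2 <= dot y y /\ dot y y <= K ^+ 2]%R))%E.
Proof.
move=> m0 lam0 lam1 r20 hK hr1 hm cz hz.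
set kap := lam * m / 2.
have kap0 : 0 < kap by rewrite /kap divr_gt0// mulr_gt0.
set rho := Num.sqrt (dot z z).
have rho2 : rho ^+ 2 = dot z z by rewrite sqr_sqrtr// dot_ge0.
have rho_ge0 : 0 <= rho by exact: sqrtr_ge0.
have rrho : r2 < rho by rewrite -(ltr_pXn2r (n := 2)) ?nnegrE ?rho2// ltW.
have rho0 : 0 < rho by lra.
(* The center [k z] has norm [(1 - lam) * r2] however far away [z] is, and [k <= 1 - lam] leaves
   weight [lam] for the ball around the origin. *)
pose k := (1 - lam) * (r2 / rho).
have q1 : r2 / rho <= 1 by rewrite ler_pdivrMr// mul1r ltW.
have q0 : 0 < r2 / rho by rewrite divr_gt0.
have k0 : 0 <= k by rewrite mulr_ge0 ?subr_ge0; lra.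
have klam : k <= 1 - lam by rewrite /k; nra.
pose a := escale k z.
have aa : dot a a = (1 - lam) ^+ 2 * r2 ^+ 2.
  by rewrite /a dotZl dotZr -rho2 /k; field; lra.
rewrite -(lebesgue_eball a)//; apply: le_measure; rewrite ?inE.
- exact: measurable_eball.
- apply: measurableI; first exact: measurable_cell.
  apply: measurableI; apply: measurable_set_ler => //; exact: measurable_dotxx.
move=> y; rewrite /eball/= => hy.
pose u := esub y a.
have uu : dot u u <= kap ^+ 2.
  by rewrite /u dotBl !dotBr (dotC a y); lra.
split.
  apply/cellE => i; set v := X i w.
  have hv : m ^+ 2 <= dot v v by exact: hm.
  have : 2 * dot z v <= dot v v by move/cellE : cz; exact.
  have : dot y v = k * dot z v + dot u v by rewrite /u /a dotBl dotZl; lra.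
  move=> -> hzv.
  have kz : k * (2 * dot z v) <= (1 - lam) * dot v v.
    apply: (@le_trans _ _ (k * dot v v)); first exact: ler_wpM2l.
    by apply: ler_wpM2r => //; exact: dot_ge0.
  (* With weight [2 / lam], 2 <u,v> <= (2 / lam) kap^2 + (lam / 2) |v|^2, where (2 / lam) kap^2 =
     (lam / 2) m^2 <= (lam / 2) |v|^2. The total is at most lam |v|^2, the share left by [kz]. *)
  have l0 : 0 < 2 / lam by rewrite divr_gt0.
  have := dot_amgm _ _ u v _ l0.
  rewrite (_ : dot v v / (2 / lam) = lam / 2 * dot v v); last by field; lra.
  have : 2 / lam * dot u u <= lam / 2 * m ^+ 2.
    apply: (@le_trans _ _ (2 / lam * kap ^+ 2)).
      by apply: ler_wpM2l => //; exact: ltW.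
    by rewrite /kap le_eqVlt; apply/orP; left; apply/eqP; field; lra.
  nra.
have yy : dot y y = dot a a + 2 * dot a u + dot u u.
  by rewrite /u dotBl !dotBr (dotC y a); lra.
have uu0 := dot_ge0 u.
have a1 : dot a a <= r2 ^+ 2 by rewrite aa; nra.
split.
  (* Weight [kap] bounds - 2 <a,u> by kap (r2^2 + 1), the correction subtracted in [hr1]. *)
  have := dot_amgm _ _ (escale (-1) a) u _ kap0.
  rewrite !(dotZl (-1)) !(dotZr (-1)) => h.
  have h2 : dot u u / kap <= kap by rewrite ler_pdivrMr// -expr2.
  apply: (le_trans hr1); rewrite -/kap yy -aa.
  have h3 : kap * dot a a <= kap * r2 ^+ 2 by rewrite ler_pM2l.
  lra.
have := dot_amgm _ _ a u _ ltr01; rewrite divr1 mul1r => h.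
by apply: le_trans hK; rewrite -/kap yy; lra.
Qed.

(** The first term bounds the event [N] that some vector has norm at most [m]. Outside [N], a large
    cell fills a ball of radius [kap] within the shell, while each point of the shell is in the cell
    with probability at most exp (- n q); Markov's inequality gives the second term. *)
Lemma prob_cell_vol_gt (m lam r1 r2 K q : R) :
  0 < m -> 0 < lam -> lam < 1 -> 0 < r2 -> 0 < K -> 0 <= q ->
  2 * r2 ^+ 2 + 2 * (lam * m / 2) ^+ 2 <= K ^+ 2 ->
  r1 ^+ 2 <= (1 - lam) ^+ 2 * r2 ^+ 2 - (lam * m / 2) * (r2 ^+ 2 + 1) ->
  (forall x, r1 ^+ 2 <= dot x x -> ((q * bv)%:E <= vol (lens x))%E) ->
  (P [set w | ((r2 ^+ d * bv)%:E < vol (cell w))%E] <=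
    (n%:R * m ^+ d + (K / (lam * m / 2)) ^+ d * expR (- (n%:R * q)))%:E)%E.
Proof.
move=> m0 lam0 lam1 r20 K0 q0 hK hr1 hq.
set kap := lam * m / 2.
have kap0 : 0 < kap by rewrite /kap divr_gt0// mulr_gt0.
set A := [set v : euclid R d | dot v v <= m ^+ 2].
have mA : measurable A by exact: measurable_ball0.
set N := \big[setU/set0]_(i < n) (X i @^-1` A).
have mN : measurable N.
  by apply: bigsetU_measurable => i _; exact: measurable_preX.
have PN : (P N <= (n%:R * m ^+ d)%:E)%E.
  apply: prob_exists_le => //; rewrite -lebesgue_ball0//.
  apply: le_measure; rewrite ?inE//.
  by apply: measurableI => //; exact: measurable_unit_ball.
set E := [set w | _].
have mE : measurable E by exact: measurable_cell_vol_gt.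
set S := [set y : euclid R d | r1 ^+ 2 <= dot y y /\ dot y y <= K ^+ 2].
have mS : measurable S.
  by apply: measurableI; apply: measurable_set_ler => //; exact: measurable_dotxx.
have volS : (vol S <= (K ^+ d * bv)%:E)%E.
  rewrite -lebesgue_ball0//; apply: le_measure; rewrite ?inE//.
    exact: measurable_ball0.
  by move=> y [].
have kb : 0 < kap ^+ d * bv by rewrite mulr_gt0 ?ball_vol_gt0// exprn_gt0.
have PE : (P (E `\` N) <= ((K / kap) ^+ d * expR (- (n%:R * q)))%:E)%E.
  rewrite -(@lee_pmul2l _ (kap ^+ d * bv)%:E) ?lte_fin//.
  apply: (@le_trans _ _ ((expR (- (n%:R * q)))%:E * vol S)%E).
    apply: (markov_xsection _ _ _ _ _ P vol cell_graph) => //.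
    - exact: measurable_cell_graph.
    - exact: measurableD.
    - by move=> x [hx _]; apply: prob_in_cell_le => //; exact: hq.
    move=> w [/= hw Nw]; rewrite xsection_cell.
    have hm i : m ^+ 2 <= dot (X i w) (X i w).
      apply: ltW; rewrite ltNge; apply/negP => hi; apply: Nw.
      by rewrite /N -bigcup_seq; exists i => //=; rewrite mem_index_enum.
    (* Otherwise the cell would lie in the ball of radius [r2], whose volume it exceeds. *)
    have [z [cz hz]] : exists z, cell w z /\ r2 ^+ 2 < dot z z.
      apply/not_existsP => h; move: hw; rewrite /E/= ltNge => /negP; apply.
      rewrite -lebesgue_ball0//; apply: le_measure; rewrite ?inE//.
      - exact: measurable_cell.
      - exact: measurable_ball0.
      by move=> z cz /=; rewrite leNgt; apply/negP => hz; apply: (h z).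
    exact: (cell_shell_volume w z m lam r1 r2 K).
  apply: (@le_trans _ _ ((expR (- (n%:R * q)))%:E * (K ^+ d * bv)%:E)%E).
    by rewrite lee_pmul2l// lte_fin expR_gt0.
  rewrite -!EFinM lee_fin (expr_div_n K kap) le_eqVlt; apply/orP; left; apply/eqP.
  have : kap ^+ d != 0 by rewrite expf_neq0// gt_eqF.
  by move: (K ^+ d) (kap ^+ d) => ? ? ?; field.
rewrite EFinD; apply: le_trans (leeD PN PE).
apply: le_trans (measureU2 _ _ _) => //; last exact: measurableD.
apply: le_measure; rewrite ?inE//.
  by apply: measurableU => //; exact: measurableD.
by move=> w Ew; have [|] := pselect (N w); [left|right].
Qed.

End voronoi_random.

(** * Limits and the rate function *)

Section limits.
Context {R : realType}.
Implicit Types (z C eps delta Q : R).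

Lemma near_geometric_le C z delta : 0 <= z -> z < 1 -> 0 < delta ->
  \forall d \near \oo, C * z ^+ d <= delta.
Proof.
move=> z0 z1 delta0; have : `|z| < 1 by rewrite ger0_norm.
move=> /(cvg_geometric C) /cvgr0_norm_le /(_ _ delta0); apply: filterS => d.
exact/le_trans/ler_norm.
Qed.

Lemma exists_exprn_ge Q C : 1 < Q -> exists k, C <= Q ^+ k.
Proof.
move=> Q1; have Q0 : 0 < Q by lra.
have d0 : 0 < (1 + `|C|)^-1 by rewrite invr_gt0 ltr_pwDl.
have Qi0 : 0 <= Q^-1 by rewrite invr_ge0 ltW.
have Qi1 : Q^-1 < 1 by rewrite invf_lt1.
have [k _ /(_ k (leqnn k)) /=] := near_geometric_le 1 Q^-1 _ Qi0 Qi1 d0.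
rewrite mul1r exprVn lef_pV2 ?posrE ?exprn_gt0 ?ltr_pwDl// => h.
by exists k; apply: le_trans h; have := ler_norm C; lra.
Qed.

(** With y = Q^d / 4, one Taylor term gives exp (- y) <= (k+1)! / y^(k+1). As Q^(k+1) >= 2 A, the
    product is at most a constant times 2^(- d). *)
Lemma near_exprn_expRN_le A Q delta : 0 < A -> 1 < Q -> 0 < delta ->
  \forall d \near \oo, A ^+ d * expR (- (Q ^+ d / 4)) <= delta.
Proof.
move=> A0 Q1 delta0; have Q0 : 0 < Q by lra.
have [k hk] := exists_exprn_ge Q (2 * A) Q1.
have hk1 : 2 * A <= Q ^+ k.+1.
  by apply: (le_trans hk); rewrite ler_weXn2l// ltW.
have h2 : 0 <= 2^-1 :> R by rewrite invr_ge0.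
have h21 : 2^-1 < 1 :> R by rewrite invf_lt1 ?ltr1n.
have := near_geometric_le (k.+1`!%:R * 4 ^+ k.+1) _ _ h2 h21 delta0.
apply: filterS => d; apply: le_trans.
set y := Q ^+ d / 4.
have y0 : 0 < y by rewrite divr_gt0// exprn_gt0.
have f0 : 0 < k.+1`!%:R :> R by rewrite ltr0n fact_gt0.
have yk0 : 0 < y ^+ k.+1 by rewrite exprn_gt0.
have hexp : expR (- y) <= k.+1`!%:R / y ^+ k.+1.
  rewrite expRN -[leRHS]invrK lef_pV2 ?posrE ?expR_gt0 ?invr_gt0 ?divr_gt0//.
  have := @expR_ge1Dxn R y k (ltW y0); rewrite invf_div; lra.
apply: (@le_trans _ _ (A ^+ d * (k.+1`!%:R / y ^+ k.+1))).
  by rewrite ler_pM2l ?exprn_gt0.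
have -> : y ^+ k.+1 = (Q ^+ k.+1) ^+ d / 4 ^+ k.+1.
  by rewrite /y expr_div_n -!exprM mulnC.
have : (2 * A) ^+ d <= (Q ^+ k.+1) ^+ d.
  by rewrite lerXn2r ?nnegrE ?exprn_ge0//; nra.
have : 0 < (Q ^+ k.+1) ^+ d by rewrite !exprn_gt0.
have : 0 < 2 ^+ d :> R by rewrite exprn_gt0.
have : 0 < 4 ^+ k.+1 :> R by rewrite exprn_gt0.
rewrite exprMn exprVn; move: f0 (ltW (exprn_gt0 d A0)).
move: (A ^+ d) (2 ^+ d) (4 ^+ k.+1) ((Q ^+ k.+1) ^+ d) (k.+1`!%:R) => a t f q g.
move=> g0 a0 f0 t0 q0 h.
have -> : a * (g / (q / f)) = g * f * (a / q) by field; lra.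
rewrite ler_pM2l ?mulr_gt0// ler_pdivrMr// mulrC ler_pdivlMr//.
by rewrite mulrC.
Qed.

(* A diagonal choice: [eps d] is the least [1/(k+1)], [k <= d], whose bad event
   has probability at most [1/(k+1)]. *)
Lemma diagonal_rate (p : R -> nat -> R) :
  (forall eps d, 0 <= p eps d <= 1) ->
  (forall eps delta, 0 < eps -> 0 < delta ->
    \forall d \near \oo, p eps d <= delta) ->
  exists eps : nat -> R, [/\ forall d, 0 < eps d, eps d @[d --> \oo] --> 0
    & p (eps d) d @[d --> \oo] --> 0].
Proof.
move=> p01 hp.
pose u k : R := k.+1%:R^-1.
have u0 k : 0 < u k by rewrite invr_gt0.
pose c d (k : 'I_d.+1) := p (u k) d <= u k.
pose k d := [arg max_(k > ord0 | c d k) (k : nat)].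
(* Index 0 always qualifies, because [u 0 = 1] bounds every probability. *)
have kP d : extremum_spec geq (c d) (fun k : 'I_d.+1 => k : nat) (k d).
  by apply: arg_maxnP; rewrite /c /u /= invr1; case/andP: (p01 1 d).
have uk delta : 0 < delta -> \forall d \near \oo, u (k d) <= delta.
  move=> delta0; pose K := Num.truncn delta^-1.
  have uK : u K <= delta.
    rewrite /u -[leRHS]invrK lef_pV2 ?posrE ?invr_gt0//.
    by rewrite ltW// truncnS_gt.
  near=> d.
  (* For large [d] the index [K] is itself a candidate, so the maximal one is at least [K]. *)
  have Kd : (K < d.+1)%N by rewrite ltnS; near: d; exact: nbhs_infty_ge.
  have cK : c d (Ordinal Kd) by rewrite /c/=; near: d; exact: hp.
  apply: le_trans uK; case: kP => i _ /(_ _ cK)/= Ki.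
  by rewrite /u lef_pV2 ?posrE// ler_nat ltnS.
exists (fun d => u (k d)); split=> //.
  by apply/cvgr0Pnorm_le => delta /uk; apply: filterS => d; rewrite gtr0_norm.
apply/cvgr0Pnorm_le => delta /uk; apply: filterS => d.
apply: le_trans; case/andP: (p01 (u (k d)) d) => h _; rewrite ger0_norm//.
by case: (kP d).
Unshelve. all: by end_near. Qed.

End limits.

Section rate_function.
Context {R : realType}.
Implicit Types (r t c : R).

(* [2 r t - t^2] at the optimal [t] is the squared radius of the smallest ball
   containing the lens cut out by a point of norm [r]. *)
Definition lens_center r : R := if r ^+ 2 <= 1 / 2 then r else (2 * r)^-1.
Definition lens_radius2 r : R := 2 * r * lens_center r - lens_center r ^+ 2.

Lemma lens_radius2E r : 0 < r ->
  lens_radius2 r = if r ^+ 2 <= 1 / 2 then r ^+ 2 else 1 - (4 * r ^+ 2)^-1.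
Proof.
by move=> r0; rewrite /lens_radius2 /lens_center; case: ifPn => _; field; lra.
Qed.

Lemma lens_centerP r : 0 < r ->
  [/\ 0 < lens_center r, lens_center r <= r, 2 * r * lens_center r <= 1 &
     lens_center r = r \/ 2 * r * lens_center r = 1].
Proof.
move=> r0; rewrite /lens_center; case: ifPn => h.
  by split => //; [rewrite -mulrA -expr2; lra | left].
rewrite -ltNge in h; have r20 : 0 < 2 * r by lra.
have e : 2 * r * (2 * r)^-1 = 1 by rewrite divff// gt_eqF.
split; [by rewrite invr_gt0| |by rewrite e|by right].
rewrite -(ler_pM2l r20) e; rewrite expr2 in h; lra.
Qed.

Lemma lens_radius2_gt0 r : 0 < r -> 0 < lens_radius2 r.
Proof.
move=> r0; have [t0 tr _ _] := lens_centerP _ r0; rewrite /lens_radius2; nra.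
Qed.

(** As functions of [r ^+ 2] both branches increase, and they agree at 1/2. Strictness makes the
    threshold sharp: any change of the radius moves [alpha ^+ 2 * lens_radius2 r] away from 1. *)
Lemma lens_radius2_lt r r' : 0 < r -> r < r' -> lens_radius2 r < lens_radius2 r'.
Proof.
move=> r0 rr'; have r'0 : 0 < r' by lra.
have h : r ^+ 2 < r' ^+ 2 by rewrite ltr_pXn2r ?nnegrE// ltW.
rewrite !lens_radius2E//; move: h (exprn_gt0 2 r0) (exprn_gt0 2 r'0).
move: (r ^+ 2) (r' ^+ 2) => a b ab a0 b0.
(* The reciprocals are replaced by variables known only through their products and signs, which
   leaves polynomial inequalities. *)
have inv (x : R) : 0 < x -> x * (4 * x)^-1 = 1 / 4 by move=> x0; field; lra.
have inv0 (x : R) : 0 < x -> 0 < (4 * x)^-1 by move=> x0; rewrite invr_gt0; lra.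
have := inv _ a0; have := inv _ b0; have := inv0 _ a0; have := inv0 _ b0.
move: (4 * a)^-1 (4 * b)^-1 => a' b' b'0 a'0 hb ha.
by case: ifPn => h1; case: ifPn => h2; rewrite -?ltNge in h1 h2; nra.
Qed.

End rate_function.

(** * Concentration of the volume *)

Section concentration.
Context {R : realType}.
Variables (alpha : R) (disp : nat -> measure_display).
Variables (Om : forall d : nat, measurableType (disp d)).
Variables (P : forall d : nat, probability (Om d) R) (n : nat -> nat).
Variables (X : forall d : nat, 'I_(n d) -> {RV (P d) >-> euclid R d}).
Hypothesis alpha1 : 1 < alpha.
Hypothesis nE : forall d : nat, `|(n d)%:R - alpha ^+ d| < 1.
Hypothesis Xunif : forall (d : nat) (i : 'I_(n d)), uniform_in unit_ball (X d i).
Hypothesis Xindep : forall d : nat, mutually_independent (X d).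
Variable r : R.
Hypotheses (r0 : 0 < r) (alphar : alpha ^+ 2 * lens_radius2 r = 1).

Let cellvol d (w : Om d) : \bar R := lebesgue_tuple d (cell (P d) d (n d) (X d) w).

Let alphaX_ge1 d : 1 <= alpha ^+ d.
Proof. by rewrite exprn_ege1// ltW. Qed.

Let n_le d : (n d)%:R <= 2 * alpha ^+ d.
Proof.
by have := nE d; have := alphaX_ge1 d; rewrite ltr_norml => ? /andP[? ?]; lra.
Qed.

Let n_ge : \forall d \near \oo, alpha ^+ d / 2 <= (n d)%:R.
Proof.
have a0 : 0 < alpha by exact: lt_trans ltr01 alpha1.
have h0 : 0 <= alpha^-1 by rewrite invr_ge0 ltW.
have h1 : alpha^-1 < 1 by rewrite invf_lt1.
have := near_geometric_le 2 _ _ h0 h1 ltr01.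
apply: filterS => d; rewrite exprVn ler_pdivrMr ?exprn_gt0// mul1r => h.
by have := nE d; rewrite ltr_norml => /andP[? ?]; lra.
Qed.

Lemma near_prob_vol_lt (eps delta : R) : 0 < eps -> 0 < delta ->
  \forall d \near \oo, (P d [set w | (cellvol d w <
    (expR (- (eps * d%:R)) * r ^+ d * ball_vol R d)%:E)%E] <= delta%:E)%E.
Proof.
move=> eps0 delta0; have a0 : 0 < alpha by exact: lt_trans ltr01 alpha1.
(* exp (- eps d) = h^d h^d: one factor shrinks [r] to [r'], the other absorbs the 1/2 of
   [prob_cell_vol_lt] once [2 * h ^+ d <= 1]. *)
pose h := expR (- (eps / 2)).
have h0 : 0 < h by exact: expR_gt0.
have h1 : h < 1 by rewrite expR_lt1; lra.
pose r' := r * h.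
have r'0 : 0 < r' by rewrite mulr_gt0.
have r'r : r' < r by rewrite /r' gtr_pMr.
have [t0 tr t1 ht] := lens_centerP _ r'0.
pose s := Num.sqrt (lens_radius2 r').
have s0 : 0 < s by rewrite sqrtr_gt0 lens_radius2_gt0.
have s2 : s ^+ 2 = lens_radius2 r' by rewrite sqr_sqrtr// ltW// lens_radius2_gt0.
(* Below the critical radius the expected number of vectors in the lens, of order at most
   [(alpha * s) ^+ d], tends to 0. *)
have as1 : alpha * s < 1.
  have as0 : 0 <= alpha * s by rewrite mulr_ge0// ltW.
  rewrite -(ltr_pXn2r (n := 2)) ?nnegrE// expr1n exprMn s2 -alphar.
  by rewrite ltr_pM2l ?exprn_gt0// lens_radius2_lt.
have as0 : 0 <= alpha * s by rewrite mulr_ge0// ltW.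
near=> d.
have hd : 2 * h ^+ d <= 1.
  near: d; exact: near_geometric_le (ltW h0) h1 ltr01.
have asd : 4 * (alpha * s) ^+ d <= delta.
  near: d; exact: near_geometric_le as0 as1 delta0.
apply: (@le_trans _ _ (P d [set w |
    (cellvol d w < (r' ^+ d * ball_vol R d / 2)%:E)%E])).
  apply: le_measure; rewrite ?inE; [exact: measurable_cell_vol_lt..|].
  move=> w /= hw; apply: (lt_le_trans hw); rewrite lee_fin.
  have -> : expR (- (eps * d%:R)) = h ^+ d * h ^+ d.
    by rewrite -exprMn /h -expRD -expRM_natr; congr expR; lra.
  rewrite /r' exprMn; have := ball_vol_gt0 (R := R) (d := d).
  have := exprn_gt0 d r0; have := exprn_gt0 d h0.
  move: (h ^+ d) (r ^+ d) (ball_vol R d) hd => x y b hx x0 y0 b0.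
  have : 0 < x * y * b by rewrite !mulr_gt0.
  nra.
apply: (le_trans (prob_cell_vol_lt (P d) d (n d) (X d) (Xunif d)
  r' _ _ t0 tr s0 ht s2)).
rewrite lee_fin; apply: le_trans asd; rewrite exprMn.
by have := n_le d; have := exprn_gt0 d s0; nra.
Unshelve. all: by end_near. Qed.

Lemma near_prob_vol_gt (eps delta : R) : 0 < eps -> 0 < delta ->
  \forall d \near \oo, (P d [set w |
    ((expR (eps * d%:R) * r ^+ d * ball_vol R d)%:E < cellvol d w)%E] <= delta%:E)%E.
Proof.
move=> eps0 delta0; have a0 : 0 < alpha by exact: lt_trans ltr01 alpha1.
pose h := expR (eps / 2).
have h0 : 0 < h by exact: expR_gt0.
have h1 : 1 < h by rewrite expR_gt1; lra.
(* [r1] is the inner radius of the shell, strictly above the critical [r]; [r2] is [r] times exp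
   (eps) and gives the volume bound. *)
pose r1 := r * h; pose r2 := r1 * h.
have r10 : 0 < r1 by rewrite mulr_gt0.
have r20 : 0 < r2 by rewrite mulr_gt0.
have rr1 : r < r1 by rewrite /r1 ltr_pMr.
have r12 : r1 < r2 by rewrite /r2 ltr_pMr.
have [t0 tr t1 _] := lens_centerP _ r10.
set t := lens_center r1 in t0 tr t1.
have F1 : (alpha ^+ 2)^-1 < lens_radius2 r1.
  have -> : (alpha ^+ 2)^-1 = lens_radius2 r.
    by rewrite -[LHS]mulr1 -alphar mulKf// expf_neq0// gt_eqF.
  exact: lens_radius2_lt.
(* The midpoint leaves room on both sides: [alpha * s > 1], and a positive gap below
   [lens_radius2 r1] for the slab. *)
pose s2 := ((alpha ^+ 2)^-1 + lens_radius2 r1) / 2.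
have ai0 : 0 < (alpha ^+ 2)^-1 by rewrite invr_gt0 exprn_gt0.
have s20 : 0 < s2 by rewrite /s2; lra.
pose s := Num.sqrt s2.
have s0 : 0 < s by rewrite sqrtr_gt0.
have sE : s ^+ 2 = s2 by rewrite sqr_sqrtr// ltW.
have as1 : 1 < alpha * s.
  have as0 : 0 <= alpha * s by rewrite mulr_ge0// ltW.
  rewrite -(ltr_pXn2r (n := 2)) ?nnegrE// expr1n exprMn sE.
  by rewrite mulrC -ltr_pdivrMr ?exprn_gt0// div1r /s2; lra.
(* A slab of half-width [g] uses up half of the gap; the other bounds on [eta] keep [eta <= t] and
   make [s'] positive. *)
pose g := (2 * r1 * t - t ^+ 2 - s2) / (4 * (t + r1)).
have gap : 0 < 2 * r1 * t - t ^+ 2 - s2.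
  by rewrite -[2 * r1 * t - t ^+ 2]/(lens_radius2 r1) /s2; lra.
have g0 : 0 < g by rewrite divr_gt0//; lra.
pose eta := Num.min t (Num.min (s / 2) g).
have eta0 : 0 < eta by rewrite !lt_min t0 g0 andbT /=; lra.
have etat : eta <= t by rewrite ge_min lexx.
have etas : eta <= s / 2 by rewrite !ge_min lexx orbT.
have etag : eta <= g by rewrite !ge_min lexx !orbT.
pose s' := Num.sqrt (s ^+ 2 - eta ^+ 2).
have s'0 : 0 < s' by rewrite sqrtr_gt0; nra.
have s'E : s' ^+ 2 = s ^+ 2 - eta ^+ 2 by rewrite sqr_sqrtr//; nra.
have s's : s' < s.
  by rewrite -(ltr_pXn2r (n := 2)) ?nnegrE ?(ltW s'0) ?(ltW s0)// s'E; nra.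
have etalt : t ^+ 2 + s ^+ 2 + 2 * (t + r1) * eta < 2 * r1 * t.
  rewrite sE; have : 2 * (t + r1) * eta <= (2 * r1 * t - t ^+ 2 - s2) / 2.
    apply: (@le_trans _ _ (2 * (t + r1) * g)).
      by rewrite ler_pM2l//; lra.
    by rewrite /g le_eqVlt; apply/orP; left; apply/eqP; field; lra.
  by lra.
(* Then [alpha * m = 2^-1], so vectors of norm at most [m] occur with probability at most
   [2 * 2^-1 ^+ d]. *)
pose m := (2 * alpha)^-1.
have m0 : 0 < m by rewrite invr_gt0; lra.
have am : alpha * m = 2^-1 by rewrite /m; field; lra.
(* Since (1 - lam)^2 >= 1 - 2 lam, [lam * D] bounds the total loss in [hr1]. *)
pose D := 2 * r2 ^+ 2 + m / 2 * (r2 ^+ 2 + 1).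
have r2sq : 0 < r2 ^+ 2 by rewrite exprn_gt0.
have D0 : 0 < D by rewrite /D; nra.
have r12sq : r1 ^+ 2 < r2 ^+ 2 by rewrite ltr_pXn2r ?nnegrE ?(ltW r10) ?(ltW r20).
pose lam := Num.min 2^-1 ((r2 ^+ 2 - r1 ^+ 2) / D).
have lam0 : 0 < lam.
  by rewrite lt_min invr_gt0 ltr0n /= divr_gt0// subr_gt0.
have lam1 : lam < 1 by rewrite gt_min invf_lt1 ?ltr1n.
have lamD : lam * D <= r2 ^+ 2 - r1 ^+ 2 by rewrite -ler_pdivlMr// ge_min lexx orbT.
have hr1 : r1 ^+ 2 <= (1 - lam) ^+ 2 * r2 ^+ 2 - (lam * m / 2) * (r2 ^+ 2 + 1).
  by move: lamD; rewrite /D; nra.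
have kap0 : 0 < lam * m / 2 by rewrite divr_gt0// mulr_gt0.
pose K := Num.sqrt (2 * r2 ^+ 2 + 2 * (lam * m / 2) ^+ 2).
have K20 : 0 < 2 * r2 ^+ 2 + 2 * (lam * m / 2) ^+ 2.
  by rewrite addr_gt0// mulr_gt0// exprn_gt0.
have K0 : 0 < K by rewrite sqrtr_gt0.
have KE : 2 * r2 ^+ 2 + 2 * (lam * m / 2) ^+ 2 <= K ^+ 2 by rewrite sqr_sqrtr// ltW.
have delta2 : 0 < delta / 2 by rewrite divr_gt0.
have h2 : 0 <= 2^-1 :> R by rewrite invr_ge0.
have h21 : 2^-1 < 1 :> R by rewrite invf_lt1 ?ltr1n.
have ss0 : 0 <= s' / s by rewrite divr_ge0// ltW.
have ss1 : s' / s < 1 by rewrite ltr_pdivrMr// mul1r.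
have A0 : 0 < K / (lam * m / 2) by rewrite divr_gt0.
near=> d.
have nd : alpha ^+ d / 2 <= (n d)%:R by near: d; exact: n_ge.
have ssd : 4 * (s' / s) ^+ d <= 1.
  near: d; exact: near_geometric_le ss0 ss1 ltr01.
have md : 2 * 2^-1 ^+ d <= delta / 2.
  near: d; exact: near_geometric_le h2 h21 delta2.
have Ad : (K / (lam * m / 2)) ^+ d * expR (- ((alpha * s) ^+ d / 4)) <= delta / 2.
  near: d; exact: near_exprn_expRN_le A0 as1 delta2.
(* Eventually [q >= s ^+ d / 2] and [n d >= alpha ^+ d / 2], hence the exponent
   [(alpha * s) ^+ d / 4] in [Ad]. *)
pose q := s ^+ d - 2 * s' ^+ d.
have sd0 : 0 < s ^+ d by rewrite exprn_gt0.
have q2 : s ^+ d / 2 <= q.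
  by move: ssd; rewrite expr_div_n mulrA ler_pdivrMr// /q; lra.
have q0 : 0 <= q by lra.
have hq (x : euclid R d) : r1 ^+ 2 <= dot x x ->
    ((q * ball_vol R d)%:E <= lebesgue_tuple d (lens x))%E.
  exact: (lens_volume_ge x r1 t s s' eta).
have -> : expR (eps * d%:R) * r ^+ d = r2 ^+ d.
  rewrite expRM_natr -exprMn /r2 /r1 -mulrA /h -expRD mulrC.
  by congr ((_ * expR _) ^+ _); lra.
apply: (le_trans (prob_cell_vol_gt (P d) d (n d) (X d) (Xunif d) (Xindep d)
  m lam r1 r2 K q m0 lam0 lam1 r20 K0 q0 KE hr1 hq)).
rewrite lee_fin (splitr delta) lerD//.
  apply: le_trans md; rewrite -am exprMn mulrA ler_pM2r ?exprn_gt0//.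
apply: le_trans Ad; rewrite ler_pM2l ?exprn_gt0// ler_expR lerN2 exprMn.
have : 0 < alpha ^+ d by rewrite exprn_gt0.
nra.
Unshelve. all: by end_near. Qed.

End concentration.

(** * Passage to the asymptotic notation and conclusion *)

(** An error [t] in the exponent multiplies the volume by exp (t l), where [l] is ln c, or 1 in the
    convention for [c = 1]. As [l] is nonzero, [t] is recovered from a logarithm. *)
Lemma pow_half_uptoE (R : realType) (c : R) (d : nat) (e w : R) (v : \bar R) :
  0 < c -> 0 < w -> 0 <= e ->
  let l := `|if c == 1 then 1 else ln c| in
  pow_half_upto c d e v w%:E <->
  ((expR (- (l * e)) * Num.sqrt c ^+ d * w)%:E <= v)%E /\
  (v <= (expR (l * e) * Num.sqrt c ^+ d * w)%:E)%E.
Proof.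
move=> c0 w0 e0 /=; set l := if c == 1 then 1 else ln c.
have l0 : l != 0.
  by rewrite /l; case: ifPn => [_|c1]; rewrite ?oner_neq0// ln_eq0.
have l_gt0 : 0 < `|l| by rewrite normr_gt0.
set q := Num.sqrt c ^+ d * w.
have q0 : 0 < q by rewrite mulr_gt0// exprn_gt0// sqrtr_gt0.
have powE t : (if c == 1 then expR t else c `^ (d%:R / 2 + t)) =
    expR (t * l) * Num.sqrt c ^+ d.
  rewrite /l; case: ifPn => [/eqP ->|c1]; first by rewrite sqrtr1 expr1n !mulr1.
  rewrite powRD; last by rewrite (gt_eqF c0) implybT.
  rewrite mulrC [d%:R / 2]mulrC powRrM powR12_sqrt ?(ltW c0)// powR_mulrn ?sqrtr_ge0//.
  by congr (_ * _); rewrite mulrC /powR gt_eqF// mulrC.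
rewrite -!mulrA -/q; split=> [[t te ->]|[]].
  rewrite powE -EFinM -mulrA -/q !lee_fin !ler_pM2r// !ler_expR.
  have : `|t * l| <= `|l| * e by rewrite normrM mulrC ler_pM2l.
  by rewrite ler_norml => /andP[].
(* The upper bound excludes +oo and the lower one -oo. *)
case: v => [v| |]; rewrite ?leye_eq ?leeNy_eq// !lee_fin => h1 h2.
have v0 : 0 < v by apply: lt_le_trans h1; rewrite mulr_gt0// expR_gt0.
have vq0 : 0 < v / q by rewrite divr_gt0.
exists (ln (v / q) / l).
  rewrite normrM normfV ler_pdivrMr// [e * _]mulrC ler_norml.
  apply/andP; split; rewrite -ler_expR lnK ?posrE//.
    by rewrite ler_pdivlMr.
  by rewrite ler_pdivrMr.
by rewrite powE divfK// lnK ?posrE// -EFinM -(mulrA (v / q)) -/q divfK// gt_eqF.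
Qed.

(** Both regimes at once: concentration holds for every fixed [eps], and [diagonal_rate] lets [eps]
    tend to 0 with [d]. *)
Lemma voronoi_volume_whp (R : realType) (alpha : R)
    (disp : nat -> measure_display)
    (Om : forall d : nat, measurableType (disp d))
    (P : forall d : nat, probability (Om d) R) (n : nat -> nat)
    (X : forall d : nat, 'I_(n d) -> {RV (P d) >-> euclid R d}) (c : R) :
  1 < alpha ->
  (forall d : nat, `|(n d)%:R - alpha ^+ d| < 1) ->
  (forall (d : nat) (i : 'I_(n d)), uniform_in unit_ball (X d i)) ->
  (forall d : nat, mutually_independent (X d)) ->
  0 < c -> alpha ^+ 2 * lens_radius2 (Num.sqrt c) = 1 ->
  exists2 e : nat -> R, e =o_\oo (fun d : nat => d%:R : R) &
    with_high_probability P (fun d => [set w |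
      pow_half_upto c d (e d) (lebesgue_tuple d (cell (P d) d (n d) (X d) w))
        (lebesgue_tuple d unit_ball)]).
Proof.
move=> alpha1 nE Xunif Xindep c0 alphac.
pose vol d w : \bar R := lebesgue_tuple d (cell (P d) d (n d) (X d) w).
set r := Num.sqrt c in alphac.
have r0 : 0 < r by rewrite sqrtr_gt0.
pose lo eps d : \bar R := (expR (- (eps * d%:R)) * r ^+ d * ball_vol R d)%:E.
pose hi eps d : \bar R := (expR (eps * d%:R) * r ^+ d * ball_vol R d)%:E.
pose bad eps d := [set w : Om d | (vol d w < lo eps d)%E] `|`
                  [set w : Om d | (hi eps d < vol d w)%E].
have mbad eps d : measurable (bad eps d).
  apply: measurableU; first exact: measurable_cell_vol_lt.
  exact: measurable_cell_vol_gt.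
have fbad eps d : P d (bad eps d) \is a fin_num by exact: fin_num_measure.
have H1 : forall eps d, 0 <= fine (P d (bad eps d)) <= 1.
  move=> eps d; rewrite fine_ge0//=.
  by rewrite -lee_fin fineK//; exact: probability_le1.
have H2 : forall eps delta : R, 0 < eps -> 0 < delta ->
    \forall d \near \oo, fine (P d (bad eps d)) <= delta.
  move=> eps delta eps0 delta0.
  have delta2 : 0 < delta / 2 by rewrite divr_gt0.
  near=> d; rewrite -lee_fin fineK// (splitr delta) EFinD.
  apply: (le_trans (measureU2 _ _ _)).
  - exact: measurable_cell_vol_lt.
  - exact: measurable_cell_vol_gt.
  apply: leeD; near: d.
  - exact: (near_prob_vol_lt alpha disp Om P n X).
  - exact: (near_prob_vol_gt alpha disp Om P n X).
have [eps [eps0 epscvg pcvg]] := diagonal_rate _ H1 H2.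
pose l := `|if c == 1 then 1 else ln c|.
have l0 : 0 < l.
  by rewrite normr_gt0; case: ifPn => [_|c1]; rewrite ?oner_neq0// ln_eq0.
(* Dividing by [l] makes the factors of [pow_half_uptoE] exactly exp (eps d) and its inverse; the
   quotient by [d] tends to 0 because [eps] does. *)
exists (fun d => eps d * d%:R / l).
  apply/eqoP => delta delta0.
  have dl : 0 < delta * l by rewrite mulr_gt0.
  near=> d.
  have h : `|eps d| <= delta * l by near: d; exact: cvgr0_norm_le epscvg _ dl.
  by rewrite !normrM normfV (gtr0_norm l0) mulrAC ler_wpM2r// ler_pdivrMr.
(* Equality with the complement, not mere inclusion, also gives measurability of the event. *)
have good d : [set w | pow_half_upto c d (eps d * d%:R / l) (vol d w)
    (lebesgue_tuple d unit_ball)] = ~` bad (eps d) d.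
  have e0 : 0 <= eps d * d%:R / l.
    by apply: divr_ge0; [apply: mulr_ge0 => //; exact: ltW|exact: ltW].
  have lK : l * (eps d * d%:R / l) = eps d * d%:R by rewrite mulrC divfK// gt_eqF.
  have := fun v => pow_half_uptoE R c d _ (ball_vol R d) v c0
    (ball_vol_gt0 (R := R) (d := d)) e0.
  rewrite /= -/l lK => iff.
  apply/seteqP; split => w /=; rewrite lebesgue_unit_ball.
    by move=> /iff[h1 h2] []/=; rewrite ltNge ?h1 ?h2.
  move=> /not_orP[/= /negP h1 /negP h2]; rewrite -!leNgt in h1 h2.
  exact/iff.
split.
  by move=> d; rewrite good; exact: measurableC.
apply: cvg_EFin.
  by apply: nearW => d; rewrite good fin_num_measure//; exact: measurableC.
have -> : fine \o (fun d => P d [set w | pow_half_upto c d (eps d * d%:R / l) (vol d w)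
    (lebesgue_tuple d unit_ball)]) = fun d => 1 - fine (P d (bad (eps d) d)).
  apply/funext => d /=; rewrite good probability_setC// -[in LHS](fineK (fbad _ _)).
  by rewrite -EFinB.
by rewrite -[X in _ --> X]subr0; apply: cvgB => //; exact: cvg_cst.
Unshelve. all: by end_near. Qed.

Theorem theorem4 (R : realType) (alpha : R)
    (disp : nat -> measure_display)
    (Om : forall d : nat, measurableType (disp d))
    (P : forall d : nat, probability (Om d) R)
    (n : nat -> nat)
    (X : forall d : nat, 'I_(n d) -> {RV (P d) >-> euclid R d}) :
  1 < alpha ->
  (forall d : nat, `|(n d)%:R - alpha ^+ d| < 1) ->
  (forall (d : nat) (i : 'I_(n d)), uniform_in unit_ball (X d i)) ->
  (forall d : nat, mutually_independent (X d)) ->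
  let L (d : nat) (w : Om d) : set (euclid R d) := range (fun i => X d i w) in
  let vol_is_pow (c : R) (e : nat -> R) (d : nat) : set (Om d) :=
    [set w | pow_half_upto c d (e d)
       (lebesgue_tuple d (voronoi (L d w))) (lebesgue_tuple d unit_ball)] in
  (alpha <= Num.sqrt 2 ->
    exists2 e : nat -> R, e =o_\oo (fun d : nat => d%:R : R) &
      with_high_probability P
        (vol_is_pow (alpha ^+ 2 / (4 * alpha ^+ 2 - 4)) e)) /\
  (Num.sqrt 2 <= alpha ->
    exists2 e : nat -> R, e =o_\oo (fun d : nat => d%:R : R) &
      with_high_probability P (vol_is_pow (1 / alpha ^+ 2) e)).
Proof.
move=> alpha1 nE Xunif Xindep L vol_is_pow.
have a0 : 0 < alpha by lra.
have a2 : 1 < alpha ^+ 2 by rewrite exprn_egt1.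
have sq2 : Num.sqrt 2 ^+ 2 = 2 :> R by rewrite sqr_sqrtr.
have key c : 0 < c ->
    alpha ^+ 2 * (if c <= 1 / 2 then c else 1 - (4 * c)^-1) = 1 ->
    exists2 e : nat -> R, e =o_\oo (fun d : nat => d%:R : R) &
      with_high_probability P (vol_is_pow c e).
  move=> c0 h; apply: (voronoi_volume_whp R alpha disp Om P n X c) => //.
  by rewrite lens_radius2E ?sqrtr_gt0// sqr_sqrtr// ltW.
split=> ha.
  have {}ha : alpha ^+ 2 <= 2.
    by rewrite -sq2 ler_pXn2r ?nnegrE ?sqrtr_ge0// ltW.
  have d0 : 0 < 4 * alpha ^+ 2 - 4 by lra.
  apply: key; first by rewrite divr_gt0//; lra.
  move: (alpha ^+ 2) a2 ha d0 => b b1 b2 d0; case: ifPn => h.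
    (* In this regime [c <= 1 / 2] forces [alpha ^+ 2 = 2], where both branches agree. *)
    have e : b = 2.
      by move: h; rewrite ler_pdivrMr//; lra.
    by rewrite e; field.
  by field; apply/andP; split; lra.
have {}ha : 2 <= alpha ^+ 2.
  by rewrite -sq2 ler_pXn2r ?nnegrE ?sqrtr_ge0// ltW.
apply: key; first by rewrite divr_gt0//; lra.
(* Here c = 1 / alpha^2 <= 1/2, so the rate is in its first branch. *)
rewrite ifT; first by field; lra.
by rewrite !div1r lef_pV2 ?posrE//; lra.
Qed.
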